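(* Let $a>1$ be an integer and let $\alpha=(1,a)$, $\beta=(2,1)$. When $(\lambda_1,\lambda_2)\to(\infty,\infty)$ through two-row partitions $\lambda=(\lambda_1,\lambda_2)$ in such a way that $\lambda_1-\lambda_2$ remains bounded, $$\mathbb{P}(P_\lambda;\alpha<\beta)\to\frac{a+1}{2^a}.$$ On the other hand, when $\lambda_2\ge1$ is fixed and $\lambda_1\to\infty$, the limit of $\mathbb{P}(P_\lambda;\alpha<\beta)$ is $1$.
   Context: The cell poset $P_\lambda$ of a partition $\lambda=(\lambda_1,\lambda_2)$, $\lambda_1\ge\lambda_2\ge1$, is the set of cells $(i,j)$ with $i\in\{1,2\}$, $1\le j\le\lambda_i$, ordered componentwise: $(i,j)\le(i',j')$ iff $i\le i'$ and $j\le j'$. For a finite poset $Q$ and $\alpha,\beta\in Q$, $e(Q)$ is the number of linear extensions of $Q$, $e(Q;\alpha<\beta)$ is the number of linear extensions placing $\alpha$ before $\beta$, and $\mathbb{P}(Q;\alpha<\beta)=e(Q;\alpha<\beta)/e(Q)$. (The probability is considered for $\lambda$ with $\lambda_1\ge a$, so that $\alpha\in P_\lambda$.) *)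

(* Defs.v *)
From HB Require Import structures.
From mathcomp Require Import all_boot all_order all_algebra.
From mathcomp Require Import all_classical all_reals all_analysis.
Set Warnings "-redundant-canonical-projection,-projection-no-head-constant".
Set Implicit Arguments.
Unset Strict Implicit.
Unset Printing Implicit Defensive.
Import Order.TTheory GRing.Theory Num.Theory.
Import numFieldNormedType.Exports.
Local Open Scope ring_scope.

Section LinearExtensions.
Variables (d : Order.disp_t) (Q : finPOrderType d).

(* An injective map from Q to 'I_#|Q| is automatically a bijection; f x is the
   (0-based) position of x. *)
Definition is_linear_extension (f : {ffun Q -> 'I_#|Q|}) : bool :=
  injectiveb f && [forall x, forall y, (x <= y)%O ==> (f x <= f y)%N].

Definition nb_linext : nat := #|[set f | is_linear_extension f]|.

Definition nb_linext_lt (x y : Q) : nat :=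
  #|[set f | is_linear_extension f & (f x < f y)%N]|.

Definition prob_lt (R : realType) (x y : Q) : R :=
  (nb_linext_lt x y)%:R / nb_linext%:R.

End LinearExtensions.

Record two_row_partition := TwoRowPartition {
  part1 : nat;
  part2 : nat;
  part2_gt0 : (1 <= part2)%N;
  part2_le_part1 : (part2 <= part1)%N }.

(* Cells are 1-based pairs (row, column). *)
Definition in_shape (l : two_row_partition) (c : nat *p nat) : bool :=
  ((c.1 == 1%N) && (1 <= c.2 <= part1 l)%N)
  || ((c.1 == 2%N) && (1 <= c.2 <= part2 l)%N).

Record cell (l : two_row_partition) := Cell {
  coords : nat *p nat;
  coordsP : in_shape l coords }.

HB.instance Definition _ l := [isSub for @coords l].
HB.instance Definition _ l := [Countable of cell l by <:].
Fact cell_display : Order.disp_t. Proof. exact: Order.Disp tt tt. Qed.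
HB.instance Definition _ l :=
  [SubChoice_isSubPOrder of cell l by <: with cell_display].

Section CellFinite.
Variable l : two_row_partition.

Definition cell_enum : seq (cell l) :=
  pmap insub [seq ((i, j) : nat *p nat) | i <- iota 1 2, j <- iota 1 (part1 l)].

Fact cell_enumP : Finite.axiom cell_enum.
Proof.
have le21 := part2_le_part1 l.
apply: Finite.uniq_enumP.
  by apply: pmap_sub_uniq; apply: allpairs_uniq; rewrite ?iota_uniq // => -[i j] [].
move=> c; rewrite mem_pmap_sub inE /=; case: c => [[i j] /= H].
have Hj : j \in iota 1 (part1 l).
  rewrite mem_iota add1n ltnS; move: H; rewrite /in_shape /=.
  by case/orP => /and3P[_ -> jl] //=; apply: leq_trans jl le21.
have Hi : i \in iota 1 2.
  by move: H; rewrite /in_shape /= => /orP[] /and3P[/eqP->].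
exact: (allpairs_f (fun i j : nat => (i, j)) Hi Hj).
Qed.

HB.instance Definition _ := fintype.isFinite.Build (cell l) cell_enumP.
End CellFinite.

(* The order inherited from [nat *p nat] is the componentwise one. *)
Fact cell_leE (l : two_row_partition) (x y : cell l) :
  (x <= y)%O = ((coords x).1 <= (coords y).1)%N
            && ((coords x).2 <= (coords y).2)%N.
Proof. by []. Qed.

(* Main.v *)
Require Import Defs.
From mathcomp Require Import all_boot all_order all_algebra.
From mathcomp Require Import all_classical all_reals all_analysis.
From mathcomp Require Import zify ring lra.
Set Implicit Arguments.
Unset Strict Implicit.
Unset Printing Implicit Defensive.
Import Order.TTheory GRing.Theory Num.Theory.
Import numFieldNormedType.Exports.

(* Recording for each position whether the cell placed there lies in the first
   row turns linear extensions of P_(p,q) into ballot words with p letters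
   [true] and q letters [false]; alpha comes before beta iff the first a letters
   are all [true].  Counting both families by reflection gives, in falling
   factorials,
     P(alpha < beta)
       = ((p+1)^_(a+1) - q^_(a+1)) / ((p+1-q) * (p+q)^_a),
   that is, a+1 times the average of k^_a / (p+q)^_a over q <= k <= p.  If p - q
   stays bounded, p/(p+q) and q/(p+q) tend to 1/2, so the average is squeezed
   to 2^-a.  If q is fixed, the lower bound p^_a / (p+q)^_a tends to 1. *)

(** * Ballot words with prescribed letter counts *)

Definition ballot (w : seq bool) :=
  forall k, count_mem false (take k w) <= count_mem true (take k w).

(** The recursion strips the last letter, so each test [q <= p] checks the ballot condition on one
    prefix. The length [n] makes the recursion structural; the list is empty unless n = p + q. *)
Fixpoint ballot_words (n p q : nat) : seq (seq bool) :=
  if n is m.+1 then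
    if q <= p then
      (if p is p'.+1 then [seq rcons w true | w <- ballot_words m p' q] else [::])
      ++ (if q is q'.+1 then [seq rcons w false | w <- ballot_words m p q']
          else [::])
    else [::]
  else if (p == 0) && (q == 0) then [:: [::]] else [::].

Lemma count_mem_rcons (w : seq bool) b c :
  count_mem c (rcons w b) = count_mem c w + (b == c).
Proof. by rewrite -cats1 count_cat /= addn0. Qed.

Lemma take_rcons_le (w : seq bool) b k : k <= size w -> take k (rcons w b) = take k w.
Proof. by move=> kw; rewrite -cats1 takel_cat. Qed.

Lemma ballot_rcons w b :
  ballot (rcons w b) <->
  ballot w /\ count_mem false (rcons w b) <= count_mem true (rcons w b).
Proof.
split=> [bw|[bw le_w] k].
  split=> [k|]; last by have := bw (size (rcons w b)); rewrite take_size.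
  have [kw|kw] := leqP k (size w).
    by have := bw k; rewrite take_rcons_le.
  by have := bw (size w); rewrite take_rcons_le // take_size take_oversize // ltnW.
have [kw|kw] := leqP k (size w); first by rewrite take_rcons_le.
by rewrite take_oversize // size_rcons.
Qed.

Lemma ballot_wordsP n p q w :
  reflect [/\ size w = n, count_mem true w = p, count_mem false w = q & ballot w]
          (w \in ballot_words n p q).
Proof.
apply: (iffP idP).
  elim: n p q w => [|n IH] p q w /=.
    case: ifP => // /andP[/eqP-> /eqP->]; rewrite inE => /eqP->.
    by split=> // k.
  case: ifP => // qp; rewrite mem_cat => /orP[].
    case: p qp => // p qp /mapP[v /IH [sv tv fv bv] ->].
    have := @ballot_rcons v true; rewrite size_rcons !count_mem_rcons sv tv fv /=.
    by rewrite addn0 addn1 => -[_ H]; split=> //; apply: H.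
  case: q qp => // q qp /mapP[v /IH [sv tv fv bv] ->].
  have := @ballot_rcons v false; rewrite size_rcons !count_mem_rcons sv tv fv /=.
  by rewrite addn0 addn1 => -[_ H]; split=> //; apply: H.
elim: n p q w => [|n IH] p q w; first by case=> /size0nil -> /= <- <-.
case/lastP: w => [|w b] [] //=; rewrite size_rcons => -[sw] tw fw.
case/ballot_rcons => bw; rewrite tw fw => qp; rewrite qp mem_cat.
move: tw fw; rewrite !count_mem_rcons; case: b => /= <- <-.
  rewrite addn1 addn0; apply/orP; left; apply: map_f; exact: IH.
rewrite addn1 addn0; apply/orP; right; apply: map_f; exact: IH.
Qed.

Lemma ballot_words_uniq n p q : uniq (ballot_words n p q).
Proof.
elim: n p q => [|n IH] p q /=; first by case: ifP.
have rinj b : injective (rcons^~ b : seq bool -> seq bool).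
  by move=> u v /rcons_inj[].
case: ifP => // qp; rewrite cat_uniq; apply/and3P; split.
- by case: p qp => // p qp; rewrite map_inj_uniq.
- case: p q qp => [|p] [|q] //= qp; apply/hasPn => v //.
  move=> /mapP[u _ ->]; apply/negP => /mapP[u' _ /rcons_inj[_ //]].
- by case: q qp => // q qp; rewrite map_inj_uniq.
Qed.

(** * Counting ballot words with a forced initial run *)

Definition starts_up a (w : seq bool) := all id (take a w).

(** The length hypothesis matters: on a word shorter than [a], [starts_up a] would also test the
    appended letter. *)
Lemma count_starts_up_rcons a b (s : seq (seq bool)) :
  {in s, forall w, a <= size w} ->
  count (starts_up a) [seq rcons w b | w <- s] = count (starts_up a) s.
Proof.
move=> Hs; rewrite count_map; apply: eq_in_count => w /Hs aw /=.
by rewrite /starts_up take_rcons_le.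
Qed.

Lemma size_ballot_words n p q w : w \in ballot_words n p q -> size w = n.
Proof. by case/ballot_wordsP. Qed.

Lemma starts_up_count a w : starts_up a w -> a <= size w -> a <= count_mem true w.
Proof.
move=> uw aw; rewrite -(cat_take_drop a w) count_cat.
suff -> : count_mem true (take a w) = a by rewrite leq_addr.
rewrite -[RHS](size_takel aw); apply/eqP; rewrite -all_count.
by apply: sub_all uw => -[].
Qed.

Lemma all_starts_up0 s : count (starts_up 0) s = size s.
Proof.
by rewrite -(count_predT s); apply: eq_count => w; rewrite /starts_up take0.
Qed.

(** Both (x+1) x^_b and (x+1)^_b (x+1-b) equal (x+1)^_(b+1). Where x+1-b would be truncated,
    (x+1)^_b vanishes. This relates the terms produced by removing a last letter. *)
Lemma ffact_shift x b : x.+1 * x ^_ b + b * x.+1 ^_ b = x.+1 * x.+1 ^_ b.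
Proof.
rewrite -ffactSS ffactnSr [_ * (_ - _)]mulnC -mulnDl.
have [bx|bx] := leqP b x.+1; first by rewrite subnK.
by rewrite (ffact_small bx) !muln0.
Qed.

(** Discrete derivative of the falling factorial. *)
Lemma ffactSnS x a : x.+1 ^_ a.+1 = x ^_ a.+1 + a.+1 * x ^_ a.
Proof.
rewrite ffactSS ffactnSr [_ * (_ - _)]mulnC -mulnDl.
have [ax|ax] := leqP a x; first by rewrite addnS subnK.
by rewrite (ffact_small ax) !muln0.
Qed.

Lemma ballot_words0 n : ballot_words n n 0 = [:: nseq n true].
Proof.
elim: n => //= n -> /=.
by rewrite -cats1 -[[:: true]]/(nseq 1 true) -nseqD addn1.
Qed.

(* The reflection-principle count C(n-a,q) - C(n-a,q-a-1) for p + q = n, with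
   denominators cleared and no subtraction; it also holds at p = q - 1, where
   there is no ballot word. *)
Lemma count_ballot_words a n p q : n = p + q -> a <= p -> q <= p.+1 ->
  count (starts_up a) (ballot_words n p q) * (q`! * p.+1`!) + (n - a)`! * q ^_ a.+1
  = (n - a)`! * p.+1 ^_ a.+1.
Proof.
elim: n p q => [|n IH] p q npq ap qp.
  have [-> ->] : p = 0 /\ q = 0 by lia.
  have -> : a = 0 by lia.
  by [].
have [q0|q_gt0] := posnP q.
  rewrite q0 npq q0 addn0 ballot_words0 /= addn0 /starts_up.
  rewrite (_ : all id _); last first.
    by apply/allP => b /mem_take; rewrite mem_nseq => /andP[_ /eqP->].
  by rewrite !mul1n muln0 addn0 -(@ffact_fact p.+1 a.+1) // subSS mulnC.
rewrite leq_eqVlt in qp; case/predU1P: qp => [qp|qp].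
  by rewrite /= qp ltnn.
rewrite /= (_ : q <= p) // count_cat.
case: q q_gt0 npq qp => // q _ npq qp.
case: p npq ap qp => // p npq ap qp.
have sub_a m : a <= m -> (m.+1 - a)`! = (m.+1 - a) * (m - a)`!.
  by move=> am; rewrite subSn.
rewrite (count_starts_up_rcons (a := a) false); last first.
  move=> w /size_ballot_words->; lia.
have IHf := IH p.+1 q ltac:(lia) ap ltac:(lia).
have an : a <= n by lia.
rewrite (sub_a n an) (factS q).
have Ep := ffact_shift p.+1 a.+1; have Eq := ffact_shift q a.+1.
(* Here [d] is the number of letters [true] outside the forced run; it turns the truncated
   subtractions into sums. *)
have : exists d, p.+2 = d + a.+1 by exists (p.+1 - a); lia.
case=> d Hd; have -> : n - a = (d + q) by lia.
rewrite (count_starts_up_rcons (a := a) true); last first.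
  by move=> w /size_ballot_words->; lia.
have Et : count (starts_up a) (ballot_words n p q.+1)
          * (q.+1`! * p.+1`!) + (n - a)`! * q.+1 ^_ a.+1 = (n - a)`! * p.+1 ^_ a.+1.
  have [ap'|pa] := leqP a p; first by apply: IH => //; lia.
  (* a = p + 1: a word with p letters [true] cannot start with a of them. *)
  rewrite [p.+1 ^_ _]ffact_small; last by lia.
  rewrite [q.+1 ^_ _]ffact_small; last by lia.
  rewrite (_ : count _ _ = 0) ?muln0 //.
  apply/eqP; rewrite -leqn0 leqNgt -has_count; apply/hasPn => w.
  move=> /ballot_wordsP[sw tw fw _]; apply/negP => /starts_up_count.
  rewrite sw tw; lia.
have En : n - a = d + q by lia.
rewrite En in IHf Et.
move: IHf Et Ep Eq; rewrite (factS p.+1) (factS q).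
set Cf := count _ _; set Ct := count _ _.
move: (p.+1 ^_ _) (p.+2 ^_ _) (q ^_ _) (q.+1 ^_ _) (_`!) (_`!) (_`!).
rewrite Hd => X' X Y' Y F P Q.
rewrite (_ : n.+1 - a = d + q.+1); last by lia.
(* The factors q+1 and p+2 = d+a+1 bring both induction hypotheses to the common factorials of the
   goal, which is then a linear combination of the four scaled equations. *)
move=> /(congr1 (muln q.+1)) Hf /(congr1 (muln (d + a.+1))) Ht.
by move=> /(congr1 (muln F)) Hp /(congr1 (muln F)) Hq; lia.
Qed.

(** * Linear extensions of the cell poset as ballot words *)

Lemma count_take_mono (w : seq bool) P k k' :
  k <= k' -> count P (take k w) <= count P (take k' w).
Proof.
move=> kk; rewrite -(take_takel w kk).
by rewrite -[X in _ <= count P X](cat_take_drop k) count_cat leq_addr.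
Qed.

Lemma count_take_nth (w : seq bool) k : k < size w ->
  count_mem (nth false w k) (take k.+1 w) = (count_mem (nth false w k) (take k w)).+1.
Proof. by move=> kw; rewrite (take_nth false kw) count_mem_rcons eqxx addn1. Qed.

(** Consequently two positions with the same letter are told apart by the number of earlier
    occurrences. *)
Lemma count_take_lt (w : seq bool) k k' : k < k' -> k < size w ->
  count_mem (nth false w k) (take k w) < count_mem (nth false w k) (take k' w).
Proof. by move=> kk kw; rewrite -count_take_nth // count_take_mono. Qed.

Section Cells.
Variable l : two_row_partition.
Local Notation n := #|{: cell l}|.

Definition row1 (x : cell l) := (coords x).1 == 1.
Definition col (x : cell l) := (coords x).2.
Definition row_len (b : bool) := if b then part1 l else part2 l.

Lemma cell_leP x y : (x <= y)%O = (row1 y ==> row1 x) && (col x <= col y).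
Proof.
rewrite cell_leE /row1 /col; congr (_ && _).
case: x y => [[i j] /= /orP[]/= /and3P[/eqP-> _ _]].
  by case=> -[i' j'] /= /orP[]/= /and3P[/eqP-> _ _].
by case=> -[i' j'] /= /orP[]/= /and3P[/eqP-> _ _].
Qed.

Lemma cell_inj x y : row1 x = row1 y -> col x = col y -> x = y.
Proof.
rewrite /row1 /col => rxy cxy; apply: val_inj => /=; move: rxy cxy.
case: x y => [[i j] /= /orP[]/= /and3P[/eqP-> _ _]].
  by case=> -[i' j'] /= /orP[]/= /and3P[/eqP-> _ _] //= _ ->.
by case=> -[i' j'] /= /orP[]/= /and3P[/eqP-> _ _] //= _ ->.
Qed.

Lemma col_gt0 x : 0 < col x.
Proof. by rewrite /col; case: x => [[i j] /= /orP[]/= /and3P[]]. Qed.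

Lemma col_le x : col x <= row_len (row1 x).
Proof.
rewrite /row_len /row1 /col.
by case: x => [[i j] /= /orP[]/= /and3P[/eqP->]].
Qed.

Lemma exists_cell b j : 0 < j <= row_len b -> exists x, row1 x = b /\ col x = j.
Proof.
move=> jb.
have H : in_shape l (if b then 1 else 2, j) by case: b jb => jb; apply/orP; [left|right].
by exists (Cell H); split=> //; case: b jb H.
Qed.

Lemma card_row_le b j : j <= row_len b ->
  #|[pred x | (row1 x == b) && (col x <= j)]| = j.
Proof.
move=> jb; rewrite cardE -(size_map col) -[RHS](size_iota 1 j).
apply: perm_size; apply: uniq_perm; rewrite ?iota_uniq //.
  rewrite map_inj_in_uniq ?enum_uniq // => x y; rewrite !mem_enum !inE.
  by move=> /andP[/eqP rx _] /andP[/eqP ry _]; apply: cell_inj; rewrite rx ry.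
move=> k; rewrite mem_iota; apply/mapP/idP => [[x]|kj].
  by rewrite mem_enum inE => /andP[_ xj] ->; rewrite col_gt0 add1n ltnS.
have [|x [rx cx]] := @exists_cell b k; first by lia.
by exists x => //; rewrite mem_enum inE rx cx eqxx /=; lia.
Qed.

Lemma card_row b : #|[pred x | row1 x == b]| = row_len b.
Proof.
rewrite -[RHS](@card_row_le b) //; apply: eq_card => x; rewrite !inE.
by case: eqP => //= <-; rewrite col_le.
Qed.

Lemma card_cell : n = part1 l + part2 l.
Proof.
rewrite -[part1 l](card_row true) -[part2 l](card_row false).
rewrite -(cardC [pred x | row1 x == true]).
by congr (_ + _); apply: eq_card => x; rewrite !inE; case: (row1 x).
Qed.

Lemma linextP (f : {ffun cell l -> 'I_n}) :
  reflect (injective f /\ forall x y, (x <= y)%O -> f x <= f y)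
          (is_linear_extension f).
Proof.
apply: (iffP andP) => -[fi fm]; split; try exact/injectiveP.
  by move=> x y; have /forallP/(_ x)/forallP/(_ y)/implyP := fm.
by apply/forallP => x; apply/forallP => y; apply/implyP; apply: fm.
Qed.

Definition word_of (f : {ffun cell l -> 'I_n}) : seq bool :=
  mkseq (fun k => [exists x, (f x == k :> nat) && row1 x]) n.

Lemma size_word_of f : size (word_of f) = n.
Proof. exact: size_mkseq. Qed.

Lemma nth_word_of (f : {ffun cell l -> 'I_n}) x :
  injective f -> nth false (word_of f) (f x) = row1 x.
Proof.
move=> fi; rewrite nth_mkseq //; apply/existsP/idP => [[y]|rx].
  by move=> /andP[/eqP/val_inj/fi->].
by exists x; rewrite eqxx.
Qed.

Lemma inj_surj (f : {ffun cell l -> 'I_n}) k : injective f -> exists x, f x = k.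
Proof.
move=> fi; have [g gK fK] := @inj_card_bij _ _ f fi ltac:(by rewrite card_ord).
by exists (g k).
Qed.

(** Since [f] is onto, the positions below [k] are the values of [f] at the cells placed before [k].
    The word [w] is only required to read the rows along [f], so that one word can serve two
    extensions in [word_of_inj]. *)
Lemma count_take_word (f : {ffun cell l -> 'I_n}) w b k :
  injective f -> size w = n -> (forall x, nth false w (f x) = row1 x) -> k <= n ->
  count_mem b (take k w) = #|[pred x | (row1 x == b) && (f x < k)]|.
Proof.
move=> fi sw wf kn; rewrite -(@map_nth_iota0 _ false) ?sw // count_map.
have /permP -> : perm_eq (iota 0 k) [seq val (f x) | x <- enum [pred x | f x < k]].
  apply: uniq_perm; rewrite ?iota_uniq ?map_inj_in_uniq ?enum_uniq //.
    by move=> x y _ _ /val_inj/fi.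
  move=> i; rewrite mem_iota /=; apply/idP/mapP => [ik|[x]].
    have [x fx] := inj_surj (Ordinal (leq_trans ik kn)) fi.
    by exists x; rewrite ?mem_enum ?inE fx.
  by rewrite mem_enum inE => fk ->.
rewrite count_map [RHS]cardE /enum_mem size_filter count_filter.
apply: eq_count => x.
by rewrite /= !inE wf.
Qed.

(** A row is a chain, so the cells of the row of [x] placed before [x] are exactly those in smaller
    columns. *)
Lemma rank_word (f : {ffun cell l -> 'I_n}) w x :
  is_linear_extension f -> size w = n -> (forall x, nth false w (f x) = row1 x) ->
  count_mem (row1 x) (take (f x) w) = (col x).-1.
Proof.
move=> /linextP[fi fm] sw wf.
have fxn : f x <= n by exact: ltnW (ltn_ord _).
rewrite (count_take_word _ fi sw wf fxn).
rewrite -[RHS](@card_row_le (row1 x)); last by have := col_le x; lia.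
apply: eq_card => y; rewrite !inE; case: eqP => //= rxy.
have cx := col_gt0 x; have [cyx|cxy] := ltnP (col y) (col x).
  rewrite (_ : col y <= _); last by lia.
  have : f y <= f x by apply: fm; rewrite cell_leP rxy implybb ltnW.
  rewrite leq_eqVlt => /orP[/eqP/val_inj/fi Eyx|//].
  by rewrite Eyx ltnn in cyx.
have : f x <= f y by apply: fm; rewrite cell_leP rxy implybb.
lia.
Qed.

Lemma word_of_ballot (f : {ffun cell l -> 'I_n}) : is_linear_extension f ->
  word_of f \in ballot_words n (part1 l) (part2 l).
Proof.
move=> lf; have /linextP[fi fm] := lf; set w := word_of f.
have sw : size w = n by exact: size_word_of.
have ct b k : k <= n ->
    count_mem b (take k w) = #|[pred x | (row1 x == b) && (f x < k)]|.
  by move=> kn; apply: count_take_word => // x; apply: nth_word_of.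
have cw b : count_mem b w = row_len b.
  rewrite -[w]take_size sw ct // -card_row; apply: eq_card => x.
  by rewrite !inE ltn_ord andbT.
apply/ballot_wordsP; split; rewrite ?cw //.
move=> k; wlog kn : k / k <= n.
  move=> H; have [kn|kn] := leqP k n; first exact: H.
  by have := H n (leqnn n); rewrite -sw take_size take_oversize // sw ltnW.
(* The m second-row cells placed before k reach column m, and the first m
   cells of the first row precede the one in column m. *)
rewrite !ct //; set m := #|_|.
have [->//|m_gt0] := posnP m.
have [y /and3P[/eqP ry fy my]|H] :=
  pickP [pred y | [&& row1 y == false, f y < k & m <= col y]].
  have m_le : m <= row_len true.
    have := col_le y; rewrite ry /row_len; have := part2_le_part1 l; lia.
  rewrite -[leqLHS](card_row_le m_le); apply: subset_leq_card; apply/fintype.subsetP => x.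
  rewrite !inE => /andP[/eqP rx cx]; rewrite rx eqxx /=.
  apply: leq_ltn_trans fy; apply: fm; rewrite cell_leP rx ry; lia.
(* Otherwise all m cells lie in the first m-1 columns of the second row, which is too few. *)
have m_le : m.-1 <= row_len false.
  rewrite -card_row (leq_trans (leq_pred _)) //; apply: subset_leq_card.
  by apply/fintype.subsetP => x; rewrite !inE => /andP[].
suff : m <= m.-1 by lia.
rewrite -[leqRHS](card_row_le m_le); apply: subset_leq_card; apply/fintype.subsetP => x.
rewrite !inE => /andP[rx fx]; rewrite rx /=; have := H x; rewrite /= rx fx /=; lia.
Qed.

(** By [rank_word], [f x] and [g x] are positions of the same letter in the common word with equally
    many earlier occurrences, hence equal. *)
Lemma word_of_inj : {in @is_linear_extension _ (cell l) &, injective word_of}.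
Proof.
move=> f g lf lg fg; have /linextP[fi _] := lf; have /linextP[gi _] := lg.
have wf := fun x => nth_word_of x fi; have wg := fun x => nth_word_of x gi.
rewrite -fg in wg; have sw := size_word_of f.
apply/ffunP => x; apply/val_inj.
have := rank_word x lf sw wf; rewrite -(rank_word x lg sw wg).
move=> E; have [H|H|//] := ltngtP (val (f x)) (val (g x)).
  by have := @count_take_lt (word_of f) _ _ H; rewrite sw wf E ltnn => /(_ (ltn_ord _)).
by have := @count_take_lt (word_of f) _ _ H; rewrite sw wg E ltnn => /(_ (ltn_ord _)).
Qed.

(* The letter at position k is sent to the next free cell of its row; the
   linear extension is the inverse of this map c. *)
Lemma word_of_onto w : w \in ballot_words n (part1 l) (part2 l) ->
  exists2 f, is_linear_extension f & word_of f = w.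
Proof.
move=> /ballot_wordsP[sw tw fw bw].
have cw b : count_mem b w = row_len b by case: b.
have tn : take n w = w by rewrite -sw take_size.
have /fin_all_exists[c Hc] (k : 'I_n) : exists x,
    row1 x = nth false w k /\ col x = (count_mem (nth false w k) (take k w)).+1.
  apply: exists_cell; rewrite -cw /=; have := @count_take_lt w k n (ltn_ord k).
  by rewrite sw tn => ->.
have ci : injective c.
  move=> k k' E; have [rk ck] := Hc k; have [rk' ck'] := Hc k'.
  rewrite -E rk in rk'; move: ck'; rewrite -E ck -rk' => -[H].
  apply/val_inj; have [kk|kk|//] := ltngtP (val k) (val k').
    by have := @count_take_lt w _ _ kk; rewrite sw H ltnn => /(_ (ltn_ord _)).
  by have := @count_take_lt w _ _ kk; rewrite sw -rk' H ltnn => /(_ (ltn_ord _)).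
have [g cK gK] : bijective c by apply: inj_card_bij => //; rewrite card_ord.
pose f := [ffun x => g x].
have fE x : f x = g x by rewrite ffunE.
have fi : injective f by move=> x y; rewrite !fE => /(can_inj gK).
have rw x : row1 x = nth false w (f x) by rewrite fE -{1}(gK x) (Hc _).1.
have colE x : col x = (count_mem (row1 x) (take (f x) w)).+1.
  by rewrite -{1}(gK x) (Hc _).2 rw fE.
exists f; last first.
  apply: (@eq_from_nth _ false); rewrite size_word_of // => k kn.
  have [x fx] := inj_surj (Ordinal kn) fi.
  by rewrite (_ : k = f x) ?nth_word_of ?rw // fx.
apply/linextP; split=> // x y; rewrite cell_leP => /andP[rxy cxy].
rewrite leqNgt; apply/negP => fyx.
have lty := @count_take_lt w _ _ fyx; rewrite sw -rw in lty.
have {}lty := lty (ltn_ord _).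
have [rE|rN] := eqVneq (row1 x) (row1 y).
  by move: cxy; rewrite !colE rE ltnS leqNgt lty.
(* The ballot condition on the prefix ending at [f y] gives at least [col y] letters [true] there,
   all before [f x]. This forces [col y < col x], a contradiction. *)
have [rx ry] : row1 x = true /\ row1 y = false by case: (row1 x) (row1 y) rxy rN => -[].
have := bw (f y).+1; have := @count_take_nth w (f y); rewrite sw => /(_ (ltn_ord _)).
rewrite -rw ry => ->.
have := @count_take_mono w (pred1 true) _ _ fyx.
move=> H1 H2.
by move: cxy; rewrite !colE rx ry ltnS leqNgt (leq_trans H2 H1).
Qed.

(** As [y] is least in the second row, the letters before [f y] are all [true] and the one at [f y]
    is [false]. So the initial run of [true] has length [f y], and it reaches [a] exactly when it
    contains [x], the a-th cell of the first row. *)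
Lemma starts_up_word_of (f : {ffun cell l -> 'I_n}) a x y : is_linear_extension f ->
  row1 x -> col x = a -> row1 y = false -> col y = 1 ->
  starts_up a (word_of f) = (f x < f y).
Proof.
move=> lf rx cx ry cy; have /linextP[fi fm] := lf; set w := word_of f.
have wf z : nth false w (f z) = row1 z by exact: nth_word_of.
have sw : size w = n by exact: size_word_of.
have kx : count_mem true (take (f x) w) = a.-1.
  by rewrite -cx -(rank_word x lf sw wf) rx.
have fyw : f y <= size w by rewrite sw; exact: ltnW (ltn_ord _).
have a_gt0 : 0 < a by rewrite -cx col_gt0.
have first_y : all id (take (f y) w).
  apply/(all_nthP false) => k; rewrite size_takel // => ky.
  rewrite nth_take //; have [z fz] := inj_surj (Ordinal (ltn_trans ky (ltn_ord _))) fi.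
  have -> : k = f z by rewrite fz.
  rewrite wf; apply/negPn/negP => rz; suff : f y <= f z by rewrite fz /= leqNgt ky.
  by apply: fm; rewrite cell_leP cy col_gt0 ry (negbTE rz).
have true_y : count_mem true (take (f y) w) = f y.
  rewrite -[RHS](size_takel fyw); apply/eqP; rewrite -all_count.
  by apply: sub_all first_y => -[].
have xlt : count_mem true (take (f x).+1 w) = a.
  by have := @count_take_nth w (f x); rewrite sw wf rx kx => -> //; rewrite prednK.
have [fxy|fyx] := ltnP (f x) (f y).
  have ay : a <= f y by rewrite -xlt -true_y count_take_mono.
  by rewrite /starts_up -(take_takel w ay); apply/allP => b /mem_take /(allP first_y).
apply/negbTE/negP => up.
have ay : f y < a.
  rewrite -xlt -{1}true_y; apply: leq_ltn_trans (count_take_mono w _ fyx) _.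
  by rewrite xlt kx; lia.
have an : a <= size w.
  by rewrite -xlt (leq_trans (count_size _ _)) // size_take_min geq_minr.
have /(all_nthP false)/(_ (f y)) := up; rewrite size_takel // nth_take // wf ry.
by move=> /(_ ay).
Qed.

Lemma card_linext_words (P : pred (seq bool)) :
  #|[set f : {ffun cell l -> 'I_n} | is_linear_extension f & P (word_of f)]|
  = count P (ballot_words n (part1 l) (part2 l)).
Proof.
rewrite cardE -size_filter -(size_map word_of); apply: perm_size; apply: uniq_perm.
- rewrite map_inj_in_uniq ?enum_uniq // => f g; rewrite !mem_enum !inE.
  by move=> /andP[lf _] /andP[lg _]; apply: word_of_inj.
- exact/filter_uniq/ballot_words_uniq.
move=> w; rewrite mem_filter; apply/mapP/andP => [[f]|[Pw /word_of_onto[f lf fw]]].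
  by rewrite mem_enum inE => /andP[lf Pf] ->; rewrite word_of_ballot.
by exists f; rewrite ?fw // mem_enum inE lf fw.
Qed.

Lemma nb_linextE : nb_linext (cell l) = size (ballot_words n (part1 l) (part2 l)).
Proof.
rewrite -count_predT -card_linext_words /nb_linext; apply: eq_card => f.
by rewrite !inE andbT.
Qed.

Lemma nb_linext_ltE a (x y : cell l) : coords x = (1, a) -> coords y = (2, 1) ->
  nb_linext_lt x y = count (starts_up a) (ballot_words n (part1 l) (part2 l)).
Proof.
move=> xE yE; rewrite -card_linext_words; apply: eq_card => f.
rewrite !inE; case lf: is_linear_extension => //=.
by rewrite (starts_up_word_of (x := x) (y := y)) // /row1 /col ?xE ?yE.
Qed.

End Cells.

(** * Bounds for the ratio of the two counts *)

Lemma leq_ffact2r a x y : x <= y -> x ^_ a <= y ^_ a.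
Proof.
elim: a => // a IH xy; rewrite !ffactnSr leq_mul ?IH //; lia.
Qed.

(** A discrete mean value estimate: by [ffactSnS] the difference telescopes into the sum of (a+1)
    k^_a over q <= k < q+d, and k^_a is monotone in k. *)
Lemma ffact_diff_bounds a q d :
  a.+1 * q ^_ a * d + q ^_ a.+1 <= (q + d) ^_ a.+1
    <= q ^_ a.+1 + a.+1 * (q + d).-1 ^_ a * d.
Proof.
elim: d => [|d /andP[IH1 IH2]]; first by rewrite addn0 !muln0 !addn0 leqnn.
rewrite addnS ffactSnS /=.
have := @leq_ffact2r a q (q + d) (leq_addr _ _).
have := @leq_ffact2r a (q + d).-1 (q + d) (leq_pred _).
move: ((q + d) ^_ a) ((q + d).-1 ^_ a) (q ^_ a) IH1 IH2 => X Y Z IH1 IH2 h1 h2.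
have {}h1 : a.+1 * d * Y <= a.+1 * d * X by rewrite leq_mul2l h1 orbT.
have {}h2 : a.+1 * Z <= a.+1 * X by rewrite leq_mul2l h2 orbT.
by lia.
Qed.

Lemma size_ballot_words_gt0 n p q : n = p + q -> q <= p -> 0 < size (ballot_words n p q).
Proof.
move=> npq qp; have := count_ballot_words npq (leq0n p) (leqW qp).
rewrite all_starts_up0 subn0 !ffactn1 lt0n => EN; apply/eqP => N0.
by move: EN; rewrite N0 mul0n => /eqP; rewrite eqn_mul2l; have := fact_gt0 n; lia.
Qed.

Section Ratio.
Variables (a n p q : nat).
Hypotheses (npq : n = p + q) (ap : a <= p) (qp : q <= p).
Let N := size (ballot_words n p q).
Let G := count (starts_up a) (ballot_words n p q).

(** Compare [count_ballot_words] at a and at 0: both carry the factor q! (p+1)!, and n! = n^_a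
    (n-a)!. *)
Lemma ballot_ratio : G * n ^_ a * (p.+1 - q) = N * (p.+1 ^_ a.+1 - q ^_ a.+1).
Proof.
have qp1 : q <= p.+1 by lia.
have an : a <= n by lia.
have := count_ballot_words npq ap qp1; rewrite -/G.
have := count_ballot_words npq (leq0n p) qp1; rewrite all_starts_up0 -/N.
rewrite subn0 !ffactn1 -(ffact_fact an).
set K := q`! * _ => EN EG.
have K_gt0 : 0 < K by rewrite muln_gt0 !fact_gt0.
have {}EN : N * K = n ^_ a * (n - a)`! * (p.+1 - q) by rewrite mulnBr; lia.
have {}EG : G * K = (n - a)`! * (p.+1 ^_ a.+1 - q ^_ a.+1) by rewrite mulnBr; lia.
apply/eqP; rewrite -(eqn_pmul2r K_gt0); apply/eqP.
move: (p.+1 - q) (p.+1 ^_ a.+1 - _) EN EG => D X EN EG.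
transitivity (G * K * (n ^_ a * D)); first by ring.
rewrite EG; transitivity (N * K * X); last by ring.
by rewrite EN; ring.
Qed.

Lemma count_starts_up_ge : a.+1 * q ^_ a * N <= G * n ^_ a.
Proof.
have D_gt0 : 0 < p.+1 - q by lia.
rewrite -(leq_pmul2r D_gt0) ballot_ratio.
have /andP[+ _] := ffact_diff_bounds a q (p.+1 - q).
rewrite subnKC ?leqW // => H.
have : a.+1 * q ^_ a * (p.+1 - q) <= p.+1 ^_ a.+1 - q ^_ a.+1 by lia.
rewrite -(leq_pmul2l (size_ballot_words_gt0 npq qp)); apply: leq_trans.
by apply/eq_leq; ring.
Qed.

Lemma count_starts_up_le : G * n ^_ a <= a.+1 * p ^_ a * N.
Proof.
have D_gt0 : 0 < p.+1 - q by lia.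
rewrite -(leq_pmul2r D_gt0) ballot_ratio.
have /andP[_ +] := ffact_diff_bounds a q (p.+1 - q).
rewrite subnKC ?leqW //= => H.
have : p.+1 ^_ a.+1 - q ^_ a.+1 <= a.+1 * p ^_ a * (p.+1 - q) by rewrite mulnBr; lia.
rewrite -(leq_pmul2l (size_ballot_words_gt0 npq qp)) => /leq_trans; apply.
by apply/eq_leq; ring.
Qed.

(** Since (p+1)^_(a+1) = (p+1) p^_a and q^_(a+1) <= q p^_a, the difference is at least (p+1-q) p^_a.
    This serves the case of fixed q, where the bound by q^_a degenerates. *)
Lemma count_starts_up_ge_top : p ^_ a * N <= G * n ^_ a.
Proof.
have D_gt0 : 0 < p.+1 - q by lia.
rewrite -(leq_pmul2r D_gt0) ballot_ratio.
have H : q ^_ a.+1 <= q * p ^_ a.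
  case: (q) qp => // r rp; rewrite ffactSS leq_mul2l leq_ffact2r //; lia.
have : p ^_ a * (p.+1 - q) <= p.+1 ^_ a.+1 - q ^_ a.+1.
  rewrite ffactSS mulnBr [_ * p.+1]mulnC; lia.
rewrite -(leq_pmul2l (size_ballot_words_gt0 npq qp)); apply: leq_trans.
by apply/eq_leq; ring.
Qed.

End Ratio.

(** * Passage to the limit *)

Local Open Scope classical_set_scope.
Local Open Scope ring_scope.

Lemma near_ge (u : nat -> nat) m : u @ \oo --> \oo ->
  \forall n \near \oo, (m <= u n)%N.
Proof. by move=> uoo; exact: (uoo _ (nbhs_infty_ge m)). Qed.

Lemma cvg_nat_ge (u v : nat -> nat) : (forall n, (u n <= v n)%N) ->
  u @ \oo --> \oo -> v @ \oo --> \oo.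
Proof.
move=> uv uoo A [m _ mA]; apply: filterS (near_ge m uoo) => n mn.
by apply: mA => /=; exact: leq_trans mn (uv n).
Qed.

Section FallingRatio.
Variable R : realType.

Lemma cvg_cst_div (c : R) (v : nat -> nat) : v @ \oo --> \oo ->
  c / (v n)%:R @[n --> \oo] --> 0.
Proof.
move=> voo; rewrite -(mulr0 c); apply: cvgMr.
apply/gtr0_cvgV0; last exact/cvgrnyP.
by near=> n; rewrite ltr0n; near: n; apply: near_ge.
Unshelve. all: by end_near. Qed.

(** The ratio is a product of a factors (u-m)/(v-m), and a fixed shift m does not affect the limit
    c. *)
Lemma cvg_ffact_ratio (u v : nat -> nat) (c : R) a :
  u @ \oo --> \oo -> v @ \oo --> \oo ->
  (u n)%:R / (v n)%:R @[n --> \oo] --> c ->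
  (u n ^_ a)%:R / (v n ^_ a)%:R @[n --> \oo] --> c ^+ a.
Proof.
move=> uoo voo uvc.
have shift m : (u n - m)%N%:R / (v n - m)%N%:R @[n --> \oo] --> c.
  rewrite -[c]divr1 -[c]subr0 -[X in _ / X]subr0.
  have lim_num : (u n)%:R / (v n)%:R - m%:R / (v n)%:R @[n --> \oo] --> c - 0.
    by apply: cvgB => //; exact: cvg_cst_div.
  (* Numerator and denominator are divided by v. The resulting [g] agrees with the shifted ratio
     once m <= u and m < v, where the natural subtractions are exact. *)
  have lim_den : 1 - m%:R / (v n)%:R @[n --> \oo] --> (1 - 0 : R).
    by apply: cvgB; [exact: cvg_cst|exact: cvg_cst_div].
  have d0 : 1 - 0 != 0 :> R by rewrite subr0 oner_neq0.
  pose g n : R := ((u n)%:R / (v n)%:R - m%:R / (v n)%:R) / (1 - m%:R / (v n)%:R).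
  have lim_g : g n @[n --> \oo] --> (c - 0) / (1 - 0) by apply: cvgM => //; exact: cvgV.
  apply: cvg_trans lim_g; apply: near_eq_cvg; near=> n.
  have mu : (m <= u n)%N by near: n; apply: near_ge.
  have mv : (m < v n)%N by near: n; apply: near_ge.
  rewrite /g !natrB ?(ltnW mv) //.
  have v0 : (v n)%:R != 0 :> R by rewrite pnatr_eq0; lia.
  have vm0 : (v n)%:R - m%:R != 0 :> R by rewrite -natrB ?(ltnW mv) // pnatr_eq0; lia.
  by field; rewrite v0 vm0.
elim: a => [|a IH].
  under eq_fun do rewrite !ffactn0 divr1; exact: cvg_cst.
under eq_fun do rewrite !ffactnSr !natrM -mulf_div.
rewrite exprSr; exact: cvgM.
Unshelve. all: by end_near. Qed.

End FallingRatio.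

Lemma prob_lt_bounds (R : realType) a (l : two_row_partition) (x y : cell l) :
  coords x = (1%N, a) -> coords y = (2%N, 1%N) ->
  let p := part1 l in let q := part2 l in
  [/\ a.+1%:R * ((q ^_ a)%:R / ((p + q) ^_ a)%:R) <= prob_lt R x y,
      prob_lt R x y <= a.+1%:R * ((p ^_ a)%:R / ((p + q) ^_ a)%:R),
      (p ^_ a)%:R / ((p + q) ^_ a)%:R <= prob_lt R x y &
      prob_lt R x y <= 1].
Proof.
move=> xE yE p q; have qp : (q <= p)%N := part2_le_part1 l.
(* The cell [x] lies in column [a] of the first row, which must be that long. *)
have ap : (a <= p)%N.
  by have := coordsP x; rewrite xE /in_shape /= orbF => /andP[].
have npq : #|{: cell l}| = (p + q)%N := card_cell l.
have N_gt0 := size_ballot_words_gt0 npq qp.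
have lower := count_starts_up_ge npq ap qp.
have upper := count_starts_up_le npq ap qp.
have lower_top := count_starts_up_ge_top npq ap qp.
rewrite /prob_lt nb_linextE (nb_linext_ltE xE yE) -/p -/q.
move: npq N_gt0 lower upper lower_top; set N := size _; set G := count _ _.
move=> -> N_gt0 lower upper lower_top.
have v_gt0 : (0 < (p + q) ^_ a)%N by rewrite ffact_gt0 (leq_trans ap) // leq_addr.
have N0 : 0 < N%:R :> R by rewrite ltr0n.
have v0 : 0 < ((p + q) ^_ a)%:R :> R by rewrite ltr0n.
split.
- rewrite mulrA ler_pdivrMr // mulrAC ler_pdivlMr // -!natrM ler_nat.
  exact: lower.
- rewrite mulrA ler_pdivlMr // mulrAC ler_pdivrMr // -!natrM ler_nat.
  exact: upper.
- rewrite ler_pdivrMr // mulrAC ler_pdivlMr // -!natrM ler_nat.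
  exact: lower_top.
- rewrite ler_pdivrMr // mul1r ler_nat; exact: count_size.
Qed.

Theorem theorem4p7 (R : realType) (a : nat) (ha : (1 < a)%N) :
  (forall (l : nat -> two_row_partition) (alpha beta : forall n, cell (l n)),
     (forall n, coords (alpha n) = (1%N, a)) ->
     (forall n, coords (beta n) = (2%N, 1%N)) ->
     part1 (l n) @[n --> \oo] --> \oo ->
     part2 (l n) @[n --> \oo] --> \oo ->
     (exists D : nat, forall n, (part1 (l n) - part2 (l n) <= D)%N) ->
     prob_lt R (alpha n) (beta n) @[n --> \oo] --> (a.+1%:R / 2 ^+ a : R))
  /\
  (forall (l2 : nat) (l : nat -> two_row_partition)
     (alpha beta : forall n, cell (l n)),
     (1 <= l2)%N ->
     (forall n, part2 (l n) = l2) ->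
     (forall n, coords (alpha n) = (1%N, a)) ->
     (forall n, coords (beta n) = (2%N, 1%N)) ->
     part1 (l n) @[n --> \oo] --> \oo ->
     prob_lt R (alpha n) (beta n) @[n --> \oo] --> (1 : R)).
Proof.
have ratio_compl (l : nat -> two_row_partition) n :
    (part1 (l n))%:R / (part1 (l n) + part2 (l n))%:R
    = 1 - (part2 (l n))%:R / (part1 (l n) + part2 (l n))%:R :> R.
  have s0 : (part1 (l n) + part2 (l n))%:R != 0 :> R.
    by rewrite pnatr_eq0; have := part2_gt0 (l n); lia.
  by rewrite -[X in X - _](divff s0) -mulrBl natrD addrK.
split=> [l alpha beta alphaE betaE p_oo q_oo [D pqD]
        |l2 l alpha beta _ qE alphaE betaE p_oo].
  set p := fun n => part1 (l n); set q := fun n => part2 (l n).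
  have v_oo : (p n + q n)%N @[n --> \oo] --> \oo.
    by apply: cvg_nat_ge p_oo => n; rewrite leq_addr.
  have q_half : (q n)%:R / (p n + q n)%:R @[n --> \oo] --> (2^-1 : R).
    (* From q <= p <= q + D one gets 1/2 - D/(2(p+q)) <= q/(p+q) <= 1/2; [lo] is a slightly weaker
       lower bound. *)
    pose lo n : R := 2^-1 - D%:R / (p n + q n)%:R.
    have lo_half : lo n @[n --> \oo] --> (2^-1 : R).
      rewrite -[X in _ --> X]subr0; apply: cvgB; first exact: cvg_cst.
      exact: cvg_cst_div.
    apply: squeeze_cvgr lo_half (cvg_cst (2^-1 : R)).
    apply: nearW => n; have qp : (q n <= p n)%N := part2_le_part1 (l n).
    have pq : (p n - q n <= D)%N := pqD n; have q0 : (0 < q n)%N := part2_gt0 (l n).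
    have s0 : 0 < (p n + q n)%:R :> R by rewrite ltr0n; lia.
    rewrite /lo lerBlDr -mulrDl ler_pdivlMr // ler_pdivrMr // natrD.
    have : (p n)%:R <= (q n)%:R + D%:R :> R by rewrite -natrD ler_nat; lia.
    have : (q n)%:R <= (p n)%:R :> R by rewrite ler_nat.
    have : 0 <= D%:R :> R by rewrite ler0n.
    by move=> *; apply/andP; split; lra.
  have p_half : (p n)%:R / (p n + q n)%:R @[n --> \oo] --> (2^-1 : R).
    under eq_fun do rewrite /p /q ratio_compl.
    rewrite (_ : 2^-1 = 1 - 2^-1 :> R); last by lra.
    by apply: cvgB; first exact: cvg_cst.
  rewrite -exprVn.
  have lim_of (u : nat -> nat) : u @ \oo --> \oo ->
      (u n)%:R / (p n + q n)%:R @[n --> \oo] --> (2^-1 : R) ->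
      a.+1%:R * ((u n ^_ a)%:R / ((p n + q n) ^_ a)%:R) @[n --> \oo]
      --> (a.+1%:R * 2^-1 ^+ a : R).
    by move=> u_oo u_half; apply: cvgMr; exact: cvg_ffact_ratio.
  have lo_lim := lim_of q q_oo q_half; have hi_lim := lim_of p p_oo p_half.
  apply: squeeze_cvgr lo_lim hi_lim; apply: nearW => n.
  by have [lo hi _ _] := prob_lt_bounds R (alphaE n) (betaE n); rewrite lo hi.
have v_oo : (part1 (l n) + part2 (l n))%N @[n --> \oo] --> \oo.
  by apply: cvg_nat_ge p_oo => n; rewrite leq_addr.
have p_one : (part1 (l n))%:R / (part1 (l n) + part2 (l n))%:R @[n --> \oo] --> (1 : R).
  have : 1 - l2%:R / (part1 (l n) + part2 (l n))%:R @[n --> \oo] --> (1 - 0 : R).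
    by apply: cvgB; [exact: cvg_cst|exact: cvg_cst_div].
  by rewrite subr0; under [in X in _ -> X]eq_fun do rewrite ratio_compl [X in X%:R / _]qE.
have lo_lim := cvg_ffact_ratio (a := a) p_oo v_oo p_one; rewrite expr1n in lo_lim.
apply: squeeze_cvgr lo_lim (cvg_cst (1 : R)).
apply: nearW => n.
by have [_ _ lo hi] := prob_lt_bounds R (alphaE n) (betaE n); rewrite lo hi.
Qed.
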